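(* Let $V$ be a stencil and let $M\in S_2^+$. Then $M$ belongs to the consistency set of the operator $\mathcal D^{\mathrm{LBR}}_V$ if and only if there exists $(e,f,g)\in V^3$ which forms an $M$-obtuse superbase of $\mathbb Z^2$.
   Context: $\Omega\subset\mathbb R^2$ is a fixed convex open bounded set, $X:=\Omega\cap\mathbb Z^2$ is assumed non-empty, and $\mathbb U$ is the set of all maps $u:X\cup\partial\Omega\to\mathbb R$. An operator $\mathcal D$ associates to each $u\in\mathbb U$ values $\mathcal D u(x)$, $x\in X$. Second order differences: for $e\in\mathbb Z^2\setminus\{0\}$, $u\in\mathbb U$, $x\in X$, let $h^{\pm}:=1$ if $x\pm e\in\Omega$, and otherwise let $h^\pm$ be the unique element of $]0,1]$ with $x\pm h^\pm e\in\partial\Omega$; set $$\Delta_e u(x):=\frac{2}{h^++h^-}\left(\frac{u(x+h^+e)-u(x)}{h^+}+\frac{u(x-h^-e)-u(x)}{h^-}\right),\qquad \Delta_e^+u(x):=\max\{0,\Delta_e u(x)\}.$$ A stencil is a finite set $V\subset\mathbb Z^2\setminus\{0\}$ with $-e\in V$ for each $e\in V$. A basis of $\mathbb Z^2$ is a pair $(f,g)\in(\mathbb Z^2)^2$ with $|\det(f,g)|=1$. A superbase of $\mathbb Z^2$ is a triplet $(e,f,g)\in(\mathbb Z^2)^3$ with $e+f+g=0$ and $(f,g)$ a basis of $\mathbb Z^2$. $S_2^+$ is the set of $2\times2$ real symmetric positive definite matrices. For $M\in S_2^+$, a superbase $(e_0,e_1,e_2)$ is $M$-obtuse iff $\langle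 e_i,Me_j\rangle\le 0$ for all $0\le i<j\le 2$. For $a,b,c\ge0$, $h(a,b,c):=bc$ if $a\ge b+c$, and likewise permuting $a,b,c$ (i.e. $ca$ if $b\geq c+a$, $ab$ if $c\geq a+b$); otherwise $h(a,b,c):=\frac12(ab+bc+ca)-\frac14(a^2+b^2+c^2)$. The MA-LBR operator with stencil $V$ is $$\mathcal D^{\mathrm{LBR}}_Vu(x):=\min\{h(\Delta^+_eu(x),\Delta^+_fu(x),\Delta^+_gu(x));\ (e,f,g)\in V^3 \text{ a superbase of }\mathbb Z^2\}$$ (with value $+\infty$ if $V^3$ contains no superbase). For $M\in S_2^+$ let $u_M\in\mathbb U$, $u_M(x):=\frac12\langle x,Mx\rangle$. The consistency set of an operator $\mathcal D$ is the set of $M\in S_2^+$ such that $\mathcal D u_M(x)=\det(M)$ for all $x\in X$. *)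

(* Defs.v *)
From HB Require Import structures.
From mathcomp Require Import all_boot all_order all_algebra.
From mathcomp Require Import finmap.
From mathcomp Require Import all_classical all_reals all_analysis.

Set Implicit Arguments.
Unset Strict Implicit.
Unset Printing Implicit Defensive.

Import Order.TTheory GRing.Theory Num.Theory numFieldNormedType.Exports.
Local Open Scope classical_set_scope.
Local Open Scope ring_scope.

Notation Z2 := 'cV[int]_2.

Definition Z2emb (R : realType) (e : Z2) : 'cV[R]_2 := map_mx intr e.

Definition dotp (R : realType) (x y : 'cV[R]_2) : R := (x^T *m y) 0 0.

Definition grid (R : realType) (Omega : set 'cV[R]_2) : set 'cV[R]_2 :=
  Omega `&` range (@Z2emb R).

Definition boundary (R : realType) (A : set 'cV[R]_2) : set 'cV[R]_2 :=
  closure A `\` interior A.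

Definition grid_dom (R : realType) (Omega : set 'cV[R]_2) : set 'cV[R]_2 :=
  grid Omega `|` boundary Omega.

Definition gridfun (R : realType) (Omega : set 'cV[R]_2) : Type :=
  grid_dom Omega -> R.

Definition operator (R : realType) (Omega : set 'cV[R]_2) : Type :=
  gridfun Omega -> grid Omega -> \bar R.

(* The step h^+ in the direction e; h^- is the step in the direction - e. The
   default value of xget is not used: for Omega open, convex and bounded,
   x \in Omega and x + e \notin Omega, exactly one t satisfies the condition. *)
Definition bstep (R : realType) (Omega : set 'cV[R]_2) (x : 'cV[R]_2) (e : Z2)
    : R :=
  if x + Z2emb R e \in Omega then 1
  else xget 1 [set t | 0 < t <= 1 /\ boundary Omega (x + t *: Z2emb R e)].

(* valL_ 0 u extends u by 0 outside its domain; the extension is only evaluated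
   at points of the domain. *)
Definition second_diff (R : realType) (Omega : set 'cV[R]_2) (e : Z2)
    (u : gridfun Omega) (x : grid Omega) : R :=
  let y : 'cV[R]_2 := \val x in
  let hp := bstep Omega y e in
  let hm := bstep Omega y (- e) in
  let ue : 'cV[R]_2 -> R := valL_ 0 u in
  2 / (hp + hm) * ((ue (y + hp *: Z2emb R e) - ue y) / hp
                   + (ue (y - hm *: Z2emb R e) - ue y) / hm).

Definition second_diff_pos (R : realType) (Omega : set 'cV[R]_2) (e : Z2)
    (u : gridfun Omega) (x : grid Omega) : R :=
  Num.max 0 (second_diff e u x).

Definition stencil (V : {fset Z2}) : Prop :=
  0 \notin V /\ {in V, forall e, - e \in V}.

Definition is_basis (f g : Z2) : bool := `|\det (row_mx f g : 'M[int]_2)| == 1.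

Definition is_superbase (e f g : Z2) : bool := (e + f + g == 0) && is_basis f g.

Definition spd (R : realType) : set 'M[R]_2 :=
  [set M | M^T = M /\ forall x : 'cV[R]_2, x != 0 -> 0 < dotp x (M *m x)].

Definition obtuse_superbase (R : realType) (M : 'M[R]_2) (e0 e1 e2 : Z2)
    : Prop :=
  [/\ is_superbase e0 e1 e2,
      dotp (Z2emb R e0) (M *m Z2emb R e1) <= 0,
      dotp (Z2emb R e0) (M *m Z2emb R e2) <= 0 &
      dotp (Z2emb R e1) (M *m Z2emb R e2) <= 0].

(* Meant for a, b, c >= 0, where the first three cases agree on overlaps. *)
Definition hLBR (R : realType) (a b c : R) : R :=
  if b + c <= a then b * c
  else if c + a <= b then c * a
  else if a + b <= c then a * b
  else (a * b + b * c + c * a) / 2 - (a ^+ 2 + b ^+ 2 + c ^+ 2) / 4.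

Definition MALBR (R : realType) (Omega : set 'cV[R]_2) (V : {fset Z2})
    : operator Omega :=
  fun u x =>
    \big[Order.min/+oo%E]_(e <- V) \big[Order.min/+oo%E]_(f <- V)
      \big[Order.min/+oo%E]_(g <- V | is_superbase e f g)
        (hLBR (second_diff_pos e u x) (second_diff_pos f u x)
              (second_diff_pos g u x))%:E.

Definition quadfun (R : realType) (Omega : set 'cV[R]_2) (M : 'M[R]_2)
    : gridfun Omega :=
  sigL (grid_dom Omega) (fun x => dotp x (M *m x) / 2).

Definition consistency_set (R : realType) (Omega : set 'cV[R]_2)
    (D : operator Omega) : set 'M[R]_2 :=
  [set M | spd M /\ forall x : grid Omega, D (@quadfun R Omega M) x = (\det M)%:E].

(* Main.v *)
Require Import Defs.
From mathcomp Require Import all_boot all_order all_algebra.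
From mathcomp Require Import finmap.
From mathcomp Require Import all_classical all_reals all_analysis.
From mathcomp Require Import ring lra.
Import Order.TTheory GRing.Theory Num.Theory numFieldNormedType.Exports.
Local Open Scope classical_set_scope.
Local Open Scope ring_scope.

(** On the quadratic function of [M], the finite difference [second_diff e] is
    exact: whatever the two steps, the first-order terms cancel and the
    normalization leaves [q e], the value at [e] of the quadratic form of [M]
    ([second_diff_quadfun]).  For this, each step must be positive and lead to
    a point where the function is defined, which holds since a segment leaving
    the open set [Omega] meets its boundary ([boundary_hit]).  Hence the
    operator does not depend on the grid point: it is the minimum of
    [hLBR (q e) (q f) (q g)] over the superbases of the stencil
    ([MALBR_quadfun]).

    It remains to compare each of these numbers to [\det M].  For a superbase
    [(e, f, g)], let [al], [be], [ga] be the opposites of [<e, M f>], [<f, M g>],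
    [<e, M g>] (the coefficients of Selling's decomposition of the form).  Since
    [e + f + g = 0], one has [q e = al + ga], [q f = al + be], [q g = be + ga],
    and the Gram determinant of [(f, g)] gives
    [\det M = al * be + be * ga + ga * al].  The three special cases of [hLBR]
    are those where [be], [ga] or [al], respectively, is nonpositive, and there
    [hLBR] exceeds [\det M] by the square of that coefficient; otherwise it is
    equal to [\det M].  So [hLBR (q e) (q f) (q g) >= \det M], with equality if
    and only if [al], [be], [ga] are all nonnegative, which is obtuseness
    ([hLBR_superbase]).  The minimum is therefore [\det M] exactly when some
    superbase of the stencil is obtuse. *)

(** * The quadratic form of a matrix *)

Lemma dotp_mulmxE {R : realType} (M : 'M[R]_2) (x y : 'cV[R]_2) :
  dotp x (M *m y) =
    x 0 0 * (M 0 0 * y 0 0 + M 0 1 * y 1 0)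
    + x 1 0 * (M 1 0 * y 0 0 + M 1 1 * y 1 0).
Proof.
rewrite /dotp !mxE !big_ord_recl big_ord0 addr0 !mxE !big_ord_recl !big_ord0 !addr0.
have -> : lift ord0 ord0 = 1 :> 'I_2 by apply/val_inj.
by [].
Qed.

Lemma det2E {R : comNzRingType} (A : 'M[R]_2) :
  \det A = A 0 0 * A 1 1 - A 0 1 * A 1 0.
Proof.
rewrite (expand_det_row _ 0) !big_ord_recl big_ord0 addr0 /cofactor !det_mx11 !mxE /=.
have <- : lift ord0 ord0 = 1 :> 'I_2 by apply/val_inj.
have -> : lift (lift ord0 ord0) 0 = 0 :> 'I_2 by apply/val_inj.
by rewrite expr0 expr1 mul1r mulN1r mulrN.
Qed.

Lemma dotpDMD {R : realType} (M : 'M[R]_2) (x v : 'cV[R]_2) (t : R) :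
  M^T = M ->
  dotp (x + t *: v) (M *m (x + t *: v)) =
  dotp x (M *m x) + 2 * t * dotp x (M *m v) + t ^+ 2 * dotp v (M *m v).
Proof.
move=> /matrixP/(_ 0 1); rewrite mxE => M10.
by rewrite !dotp_mulmxE !mxE M10; ring.
Qed.

Lemma spd_ge0 {R : realType} (M : 'M[R]_2) (x : 'cV[R]_2) :
  spd M -> 0 <= dotp x (M *m x).
Proof.
move=> [_ Mpos]; have [->|/Mpos/ltW //] := eqVneq x 0.
by rewrite dotp_mulmxE !mxE !mul0r addr0.
Qed.

Lemma Z2embD {R : realType} (e f : Z2) : Z2emb R (e + f) = Z2emb R e + Z2emb R f.
Proof. exact: map_mxD. Qed.

Lemma Z2embN {R : realType} (e : Z2) : Z2emb R (- e) = - Z2emb R e.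
Proof. exact: map_mxN. Qed.

(** The matrix [P] with columns [f], [g] satisfies [\det P ^+ 2 = 1], so the Gram
    matrix [P^T *m M *m P] has the determinant of [M]. *)
Lemma gram_det {R : realType} {M : 'M[R]_2} {f g : Z2} :
  M^T = M -> is_basis f g ->
  \det M = dotp (Z2emb R f) (M *m Z2emb R f) * dotp (Z2emb R g) (M *m Z2emb R g)
           - dotp (Z2emb R f) (M *m Z2emb R g) ^+ 2.
Proof.
move=> /matrixP/(_ 0 1); rewrite mxE => M10 /eqP dfg.
have fE i : (row_mx f g : 'M[int]_2) i 0 = f i 0.
  by rewrite -(row_mxEl f g i 0); congr (row_mx f g i _); apply/val_inj.
have gE i : (row_mx f g : 'M[int]_2) i 1 = g i 0.
  by rewrite -(row_mxEr f g i 0); congr (row_mx f g i _); apply/val_inj.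
have : ((\det (row_mx f g : 'M[int]_2)) ^+ 2)%:~R = 1 :> R.
  by rewrite -real_normK ?num_real // dfg expr1n.
rewrite !det2E !fE !gE !dotp_mulmxE !mxE rmorphXn rmorphB !rmorphM /= => E.
by rewrite -[LHS]mulr1 -[X in _ * X]E M10; ring.
Qed.

(** * Second differences of the quadratic function *)

(** Otherwise the part of [`[0, 1]] sent to [Omega] would also be the part sent
    to [closure Omega], hence open and closed in a connected set. *)
Lemma boundary_hit {R : realType} {Omega : set 'cV[R]_2} {x v : 'cV[R]_2} :
  open Omega -> Omega x -> ~ Omega (x + v) ->
  exists t : R, 0 < t <= 1 /\ boundary Omega (x + t *: v).
Proof.
move=> oO Ox nOv; apply: contrapT => noex.
have fc : continuous (fun t : R => x + t *: v).
  move=> t; apply: cvgD; first exact: cvg_cst.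
  by apply: cvgZr_tmp; exact: cvg_id.
pose A : set R := `[0, 1]%classic `&` (fun t : R => x + t *: v) @^-1` Omega.
have intE : interior Omega = Omega by move/interior_id: oO.
suff AE : A = `[0, 1]%classic.
  have : A 1 by rewrite AE /= in_itv /= ler01 lexx.
  by rewrite /A /= scale1r => -[].
apply: (@segment_connected R 0 1).
- by exists 0; split; rewrite /= ?in_itv /= ?lexx ?ler01 ?scale0r ?addr0.
- exists ((fun t : R => x + t *: v) @^-1` Omega) => //.
  by apply: open_comp => // t _; exact: fc.
- exists ((fun t : R => x + t *: v) @^-1` closure Omega).
    by apply: closed_comp => [t _|]; [exact: fc|exact: closed_closure].
  apply/seteqP; split => t [/= tI tO]; split => //=.
    exact: subset_closure.
  apply: contrapT => nO; apply: noex; exists t; split; last first.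
    by split; rewrite ?intE.
  move: tI; rewrite in_itv /= => /andP[t0 ->]; rewrite andbT lt_neqAle t0 andbT.
  by apply/eqP => t0'; apply: nO; rewrite -t0' scale0r addr0.
Qed.

(** A second difference divides by the steps and reads the function at the points
    that they lead to, hence these two properties. *)
Lemma bstep_spec {R : realType} {Omega : set 'cV[R]_2} {x : 'cV[R]_2} (e : Z2) :
  open Omega -> grid Omega x ->
  0 < bstep Omega x e /\ grid_dom Omega (x + bstep Omega x e *: Z2emb R e).
Proof.
move=> oO [Ox [z _ zx]]; rewrite /bstep; case: ifPn => [/set_mem xeO|/negP xeO].
  rewrite scale1r; split => //; left; split => //.
  by exists (z + e) => //; rewrite Z2embD zx.
have /(xgetPex 1) := boundary_hit oO Ox (fun h => xeO (mem_set h)).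
set t := xget _ _ => -[/andP[t0 _] bt]; split => //; by right.
Qed.

(** Along [e], the quadratic function is a polynomial of degree 2 in the step, and
    the difference quotient with two unequal steps is exact on those. *)
Lemma second_diff_quadfun {R : realType} (Omega : set 'cV[R]_2) (M : 'M[R]_2)
    (e : Z2) (x : grid Omega) :
  open Omega -> M^T = M ->
  second_diff e (quadfun (Omega := Omega) M) x = dotp (Z2emb R e) (M *m Z2emb R e).
Proof.
move=> oO Msym; rewrite /second_diff.
have gx : grid Omega (\val x) by apply: set_mem; exact: valP.
move: (\val x) gx => y gy.
have [hp0 gp] := bstep_spec e oO gy.
have [hm0] := bstep_spec (- e) oO gy.
move: (bstep _ _ e) (bstep _ _ (- e)) hp0 gp hm0 => hp hm hp0 gp hm0.
rewrite Z2embN (scalerN hm (Z2emb R e)) => gm.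
have quadE z : grid_dom Omega z ->
    valL_ 0 (quadfun (Omega := Omega) M) z = dotp z (M *m z) / 2.
  move=> gz; rewrite /quadfun -[LHS]/((valL_ 0 \o sigL _) _ z) sigLK patchE.
  by rewrite mem_set.
rewrite !quadE //; last by left.
rewrite -(scaleNr hm (Z2emb R e)) !dotpDMD //; field.
by rewrite !gt_eqF // addr_gt0.
Qed.

(** * Comparison with the determinant *)

(** Each special case exceeds the left-hand side by a square, for instance
    [(al + be) * (be + ga) = al * be + be * ga + ga * al + be ^+ 2]; the generic
    case is an identity. *)
Lemma hLBR_ge {R : realType} (al be ga : R) :
  al * be + be * ga + ga * al <= hLBR (al + ga) (al + be) (be + ga).
Proof.
by rewrite /hLBR; do 3?case: ifPn => _; nra.
Qed.

(** In a special case, equality makes the square in excess vanish; when [be = 0],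
    for instance, the other two coefficients are the nonnegative numbers
    [al + be] and [be + ga]. *)
Lemma hLBR_eqP {R : realType} (al be ga : R) :
  0 <= al + ga -> 0 <= al + be -> 0 <= be + ga ->
  hLBR (al + ga) (al + be) (be + ga) = al * be + be * ga + ga * al <->
  [/\ 0 <= al, 0 <= be & 0 <= ga].
Proof.
move=> a0 b0 c0; rewrite /hLBR.
case: ifPn => h1; [|case: ifPn => h2; [|case: ifPn => h3]]; (split; last first).
1,3,5,7: move=> [? ? ?].
- have -> : be = 0 by lra. by ring.
- have -> : ga = 0 by lra. by ring.
- have -> : al = 0 by lra. by ring.
- by field.
- move=> /eqP; rewrite -subr_eq0 => /eqP E.
  have /eqP : be ^+ 2 = 0 by rewrite -E; ring.
  by rewrite sqrf_eq0 => /eqP be0; split; lra.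
- move=> /eqP; rewrite -subr_eq0 => /eqP E.
  have /eqP : ga ^+ 2 = 0 by rewrite -E; ring.
  by rewrite sqrf_eq0 => /eqP ga0; split; lra.
- move=> /eqP; rewrite -subr_eq0 => /eqP E.
  have /eqP : al ^+ 2 = 0 by rewrite -E; ring.
  by rewrite sqrf_eq0 => /eqP al0; split; lra.
- by move=> _; split; lra.
Qed.

(** The values of the form on a superbase are the pairwise sums to which [hLBR_ge]
    and [hLBR_eqP] apply. *)
Lemma hLBR_superbase {R : realType} {M : 'M[R]_2} {e f g : Z2} :
  spd M -> is_superbase e f g ->
  let q v := dotp (Z2emb R v) (M *m Z2emb R v) in
  \det M <= hLBR (q e) (q f) (q g) /\
  (hLBR (q e) (q f) (q g) = \det M <-> obtuse_superbase M e f g).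
Proof.
move=> Mspd sb q; have [Msym _] := Mspd.
have [/eqP efg0 fgb] := andP sb.
pose al := - dotp (Z2emb R e) (M *m Z2emb R f).
pose be := - dotp (Z2emb R f) (M *m Z2emb R g).
pose ga := - dotp (Z2emb R e) (M *m Z2emb R g).
have eE : Z2emb R e = - (Z2emb R f + Z2emb R g).
  by rewrite -Z2embD -Z2embN; congr Z2emb; apply/eqP; rewrite -addr_eq0 addrA efg0.
have M10 : M 1 0 = M 0 1 by move/matrixP: Msym => /(_ 0 1); rewrite mxE.
have qe : q e = al + ga.
  by rewrite /q /al /ga eE !dotp_mulmxE !mxE; ring.
have qf : q f = al + be.
  by rewrite /q /al /be eE !dotp_mulmxE !mxE M10; ring.
have qg : q g = be + ga.
  by rewrite /q /ga /be eE !dotp_mulmxE !mxE; ring.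
have detE : \det M = al * be + be * ga + ga * al.
  by rewrite (gram_det Msym fgb) -/(q f) -/(q g) qf qg -[dotp _ _]opprK -/be; ring.
have q0 v : 0 <= q v by exact: spd_ge0.
rewrite detE qe qf qg; split; first exact: hLBR_ge.
rewrite hLBR_eqP -?qe -?qf -?qg // /obtuse_superbase sb.
by rewrite !oppr_ge0; split=> [[]|[]].
Qed.

(** * The operator on the quadratic function *)

Lemma MALBR_quadfun {R : realType} {Omega : set 'cV[R]_2} (V : {fset Z2})
    (M : 'M[R]_2) (x : grid Omega) :
  open Omega -> spd M ->
  let q v := dotp (Z2emb R v) (M *m Z2emb R v) in
  MALBR V (quadfun (Omega := Omega) M) x =
  \big[Order.min/+oo%E]_(e <- V) \big[Order.min/+oo%E]_(f <- V)
    \big[Order.min/+oo%E]_(g <- V | is_superbase e f g)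
      (hLBR (q e) (q f) (q g))%:E.
Proof.
move=> oO Mspd q; have [Msym _] := Mspd.
have dE v : second_diff_pos v (quadfun (Omega := Omega) M) x = q v.
  by rewrite /second_diff_pos second_diff_quadfun // max_r // spd_ge0.
by do 2![apply: eq_bigr => ? _]; apply: eq_bigr => ? _; rewrite !dE.
Qed.

Lemma bigmin_attained {d : Order.disp_t} {T : orderType d} {I : eqType} {t m : T}
    {s : seq I} {P : pred I} {F : I -> T} :
  m != t -> \big[Order.min/t]_(i <- s | P i) F i = m ->
  exists i, [/\ i \in s, P i & F i = m].
Proof.
rewrite big_seq_cond => /eqP mt minE.
suff [mE|[i [*]]] : let m' := \big[Order.min/t]_(i <- s | (i \in s) && P i) F i in
    m' = t \/ exists i, [/\ i \in s, P i & F i = m'].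
- by case: mt; rewrite -minE.
- by exists i; split; rewrite -?minE.
apply: (big_ind (fun m' => m' = t \/ exists i, [/\ i \in s, P i & F i = m'])).
- by left.
- by move=> x y; rewrite minElt; case: ifP.
- by move=> i /andP[]; right; exists i.
Qed.

Theorem theorem1p7 (R : realType) (Omega : set 'cV[R]_2)
    (Omega_convex : convex_set Omega) (Omega_open : open Omega)
    (Omega_bounded : bounded_set Omega) (grid_nonempty : grid Omega !=set0)
    (V : {fset Z2}) (V_stencil : stencil V) (M : 'M[R]_2) (M_spd : spd M) :
  consistency_set (@MALBR R Omega V) M <->
  exists e f g : Z2,
    [/\ e \in V, f \in V, g \in V & obtuse_superbase M e f g].
Proof.
split=> [[_ cons]|[e [f [g [eV fV gV obt]]]]].
- (* The value [+oo] of a minimum over no superbase is excluded. *)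
  have dN : (\det M)%:E != +oo%E by [].
  have [y gy] := grid_nonempty.
  have := cons (SigSub (mem_set gy)); rewrite MALBR_quadfun //.
  case/(bigmin_attained dN) => e [eV _].
  case/(bigmin_attained dN) => f [fV _].
  case/(bigmin_attained dN) => g [gV sb].
  move=> -[heq]; exists e, f, g; split => //.
  by have [_ /iffLR] := hLBR_superbase M_spd sb; exact.
- split=> // x; rewrite MALBR_quadfun //.
  have sb : is_superbase e f g by case: obt.
  apply/eqP; rewrite eq_le; apply/andP; split.
    apply: (@bigmin_inf_seq _ _ _ V _ e) => //.
    apply: (@bigmin_inf_seq _ _ _ V _ f) => //.
    apply: (@bigmin_inf_seq _ _ _ V _ g) => //.
    by have [_ /iffRL ->] := hLBR_superbase M_spd sb.
  apply: le_bigmin => [|e' _]; first exact: leey.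
  apply: le_bigmin => [|f' _]; first exact: leey.
  apply: le_bigmin => [|g' sb']; first exact: leey.
  by rewrite lee_fin; have [] := hLBR_superbase M_spd sb'.
Qed.
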